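(* Let $K$ be a nonempty convex compact subset of a locally convex space. Then the following assertions are equivalent: (a) $K\in \mathcal{SC}$, i.e. there exists a lower semicontinuous strictly convex function $f\colon K\to\mathbb{R}$; (b) there exists a symmetric $\rho$ on $K$ such that $Dz_{\rho}(K)\leq \omega$; (c) there exists a symmetric $\rho$ on $K$ such that $Dz_{\rho}(K)\leq \omega_1$.
   Context: All vector spaces are real and locally convex spaces are Hausdorff. A function $f$ on $K$ is strictly convex if $f(\lambda x+(1-\lambda)y)<\lambda f(x)+(1-\lambda)f(y)$ for all $x\neq y$ in $K$ and $\lambda\in(0,1)$. A symmetric on $K$ is a function $\rho\colon K\times K\to[0,+\infty)$ such that $\rho(x,y)=\rho(y,x)$, and $\rho(x,y)=0$ if and only if $x=y$ (no triangle inequality, and no relation with the topology of $K$, is required). For $A\subset K$, $\rho\text{-diam}(A)=\sup\{\rho(x,y):x,y\in A\}$. A slice of a set $C$ is the intersection of $C$ with an open halfspace $\{z: g(z)>r\}$, where $g$ is a continuous linear functional and $r\in\mathbb{R}$. For $\varepsilon>0$ and a compact convex $C\subset K$ put $$[C]'_\varepsilon=\{x\in C: \text{every slice } S \text{ of } C \text{ with } x\in S \text{ satisfies } \rho\text{-diam}(S)\ge\varepsilon\}.$$ Iterate: $[K]^0_\varepsilon=K$, $[K]^{\alpha+1}_\varepsilon=[[K]^\alpha_\varepsilon]'_\varepsilon$, and intersections are taken at limit ordinals. Set $Dz_\rho(K,\varepsilon)=\min\{\alpha:[K]^\alpha_\varepsilon=\emptyset\}$ if such an ordinal exists and $Dz_\rho(K,\varepsilon)=\infty$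 (beyond all ordinals) otherwise, and $Dz_\rho(K)=\sup_{\varepsilon>0}Dz_\rho(K,\varepsilon)$. Here $\omega$ is the first infinite ordinal and $\omega_1$ the first uncountable ordinal. *)

(* Defs.v *)
From mathcomp Require Import all_boot all_order all_algebra.
From mathcomp Require Import all_classical all_reals all_analysis.

Set Implicit Arguments.
Unset Strict Implicit.
Unset Printing Implicit Defensive.

Import Order.TTheory GRing.Theory Num.Theory.
Import numFieldNormedType.Exports.

Local Open Scope classical_set_scope.
Local Open Scope ring_scope.

(* Ordinal notations: [Osup f] denotes the supremum of the family [f], which
   need not be increasing.  Every small ordinal has a notation, in general
   several; [Ole] compares the ordinals denoted, so that equality of ordinals
   is [Oeq] and not [=].  The index types range over a fixed universe, which
   bounds the ordinals represented; all countable ordinals and [omega1] are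
   among them. *)
Inductive Ord : Type :=
| Ozero
| Osucc of Ord
| Osup (I : Type) of (I -> Ord).

(* [P] holds of one of the ordinals [c] in the family, read off the notation
   [b], of which [b] is the least strict upper bound; hence
   [Ole (Osucc a) b] says that [a <= c < b] for some [c]. *)
Fixpoint Oexlt (P : Ord -> Prop) (b : Ord) : Prop :=
  match b with
  | Ozero => False
  | Osucc b' => P b'
  | Osup _ f => exists i, Oexlt P (f i)
  end.

Fixpoint Ole (a b : Ord) : Prop :=
  match a with
  | Ozero => True
  | Osucc a' => Oexlt (Ole a') b
  | Osup _ f => forall i, Ole (f i) b
  end.

Definition Olt (a b : Ord) : Prop := Ole (Osucc a) b.

Definition Oeq (a b : Ord) : Prop := Ole a b /\ Ole b a.

Lemma Oexlt_mono (P Q : Ord -> Prop) b :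
  (forall c, P c -> Q c) -> Oexlt P b -> Oexlt Q b.
Proof.
move=> PQ; elim: b => [//|b _ /=|I f IH /= [i Pi]]; first exact: PQ.
by exists i; exact: IH.
Qed.

Lemma Ole_Osup a I (f : I -> Ord) i : Ole a (f i) -> Ole a (Osup f).
Proof.
elim: a => [//|a _ /= H|J g IH /= H j]; first by exists i.
by apply: IH; exact: H.
Qed.

Lemma Ole_refl a : Ole a a.
Proof. by elim: a => [//|a //|I f IH /= i]; apply: Ole_Osup; exact: IH. Qed.

Lemma Ole_trans b a c : Ole a b -> Ole b c -> Ole a c.
Proof.
elim: a b c => [//|a IH|I f IH] b c /=; last by move=> H bc i; exact: IH (H i) bc.
elim: b c => [//|b _|J g IHg] c /=.
  by move=> ab; apply: Oexlt_mono => d; exact: IH.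
by move=> [j Hj] H; exact: IHg Hj (H j).
Qed.

Lemma Ole_succ a : Ole a (Osucc a).
Proof.
elim: a => [//|a //|I f IH i].
have : Ole (Osucc (f i)) (Osucc (Osup f)) by exact/Ole_Osup/Ole_refl.
exact: Ole_trans (IH i).
Qed.

Lemma Olt_Ole a b : Olt a b -> Ole a b.
Proof. by apply: Ole_trans; exact: Ole_succ. Qed.

Lemma Ole_total a b : Ole a b \/ Olt b a.
Proof.
elim: a b => [|a IH|I f IH] b; first by left.
- have : Oexlt (Ole a) b \/ Ole b a.
    elim: b => [|b _|J g IHg]; [by right|exact: IH|].
    have [[j Hj]|H] := pselect (exists j, Oexlt (Ole a) (g j)).
      by left; exists j.
    by right => j; case: (IHg j) => // Hj; case: H; exists j.
  by case; [left|right].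
- have [[i Hi]|H] := pselect (exists i, Olt b (f i)).
    by right; exists i.
  by left => i; case: (IH i b) => // Hi; case: H; exists i.
Qed.

Lemma Olt_irr a : ~ Olt a a.
Proof.
elim: a => [//|a //|I f IH [i]].
rewrite -/(Olt (Osup f) (f i)) => H; apply: (IH i).
have H' : Ole (Osucc (f i)) (Osucc (Osup f)) by exact/Ole_Osup/Ole_refl.
exact: Ole_trans H' H.
Qed.

Lemma Olt_wf : well_founded Olt.
Proof.
suff H a b : Ole b a -> Acc Olt b by move=> a; exact: H (Ole_refl a).
elim: a b => [|a IH|I f IH] b ba; constructor => c cb.
- by have /= := Ole_trans cb ba.
- by apply: IH; exact: Ole_trans cb ba.
- by have [i ci] := Ole_trans cb ba; apply: IH (i) _ (Olt_Ole ci).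
Qed.

Lemma Oex_least (P : Ord -> Prop) : (exists a, P a) ->
  exists a, P a /\ forall b, P b -> Ole a b.
Proof.
move=> [a]; elim/(well_founded_ind Olt_wf): a => a IH Pa.
have [[b [ba Pb]]|H] := pselect (exists b, Olt b a /\ P b); first exact: IH Pb.
exists a; split => // b Pb; case: (Ole_total a b) => // ba.
by case: H; exists b.
Qed.

Definition Oleast (P : Ord -> Prop) (ex : exists a, P a) : Ord :=
  projT1 (cid (Oex_least ex)).

Definition omega : Ord := Osup (fun n : nat => iter n Osucc Ozero).

(* The set of ordinals below [a] is countable, up to [Oeq]. *)
Definition Ocountable (a : Ord) : Prop :=
  exists A : set Ord, countable A /\
    forall b, Olt b a -> exists2 c, A c & Oeq c b.

(* Notations for the countable ordinals, used only to show that an uncountable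
   ordinal exists. *)
Inductive Brouwer : Type :=
| Bzero
| Bsucc of Brouwer
| Bsup of (nat -> Brouwer).

Fixpoint Ord_of_Brouwer (t : Brouwer) : Ord :=
  match t with
  | Bzero => Ozero
  | Bsucc t' => Osucc (Ord_of_Brouwer t')
  | Bsup u => Osup (fun n => Ord_of_Brouwer (u n))
  end.

Lemma Oex_uncountable : exists a, ~ Ocountable a.
Proof.
exists (Osup Ord_of_Brouwer) => -[A [Acount HA]].
have below t : Olt (Ord_of_Brouwer t) (Osup Ord_of_Brouwer).
  exists (Bsucc t); exact: Ole_refl.
have /countable_injP[e einj] := Acount.
pose P n t := exists2 c, A c & e c = n /\ Ole c (Ord_of_Brouwer t).
pose u n := if pselect (exists t, P n t) is left h
  then projT1 (cid h) else Bzero.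
have [c Ac [le1 le2]] := HA _ (below (Bsucc (Bsup u))).
apply: (@Olt_irr (Ord_of_Brouwer (Bsup u))); apply: Ole_trans le2 _.
apply: (@Ole_Osup _ _ _ (e c)); rewrite /u; case: pselect => [h|[]].
  have [c' Ac' [ec' le']] := projT2 (cid h).
  have cc : c' = c by apply: (einj _ _ _ _ ec'); rewrite inE.
  by rewrite cc in le'.
by exists (Bsucc (Bsup u)); exists c.
Qed.

Definition omega1 : Ord := Oleast Oex_uncountable.

Lemma omega1P :
  ~ Ocountable omega1 /\ forall b, Olt b omega1 -> Ocountable b.
Proof.
rewrite /omega1 /Oleast; case: cid => w /= [nw H]; split=> // b bw.
have [//|/H wb] := pselect (Ocountable b).
by have := @Olt_irr _ (Ole_trans bw wb).
Qed.

(* Ordinals extended by [None], standing for the symbol [oo] which is beyond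
   all ordinals. *)
Definition eOle (a b : option Ord) : Prop :=
  match a, b with
  | _, None => True
  | None, Some _ => False
  | Some a', Some b' => Ole a' b'
  end.

Definition eOsup (I : Type) (f : I -> option Ord) : option Ord :=
  if `[< exists i, f i = None >] then None
  else Some (Osup (fun i => odflt Ozero (f i))).

Lemma eOsupP (I : Type) (f : I -> option Ord) (b : option Ord) :
  eOle (eOsup f) b <-> forall i, eOle (f i) b.
Proof.
rewrite /eOsup; case: asboolP => [[i fi]|H].
- split; first by case: b => // _ j; case: (f j).
  by move/(_ i); rewrite fi; case: b.
- case: b => [b|] /=; last by split=> // _ i; case: (f i).
  have fE i : f i = Some (odflt Ozero (f i)).
    by case E : (f i) => //; case: H; exists i.
  by split=> h i; have := h i; rewrite [in X in _ -> X]fE // {1}fE.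
Qed.

Section Dentability.
Context (R : realType) (E : tvsType R).
Implicit Types (C K S : set E) (rho : E -> E -> R) (eps : R).

(* A symmetric on [K]; only the values of [rho] on [K `*` K] matter. *)
Definition symmetric_on K rho : Prop :=
  forall x y, K x -> K y ->
    [/\ 0 <= rho x y, rho x y = rho y x & rho x y = 0 <-> x = y].

(* This is [-oo] on the empty set, but only nonempty slices are measured. *)
Definition diam rho S : \bar R :=
  ereal_sup [set (rho p.1 p.2)%:E | p in S `*` S].

Definition slice C S : Prop :=
  exists (g : {linear E -> R^o}) (r : R),
    continuous g /\ S = C `&` [set z | r < g z].

Definition derivative rho eps C : set E :=
  [set x | C x /\ forall S, slice C S -> S x -> (eps%:E <= diam rho S)%E].

(* The intersection with [K] matters only for empty families.  The last clause
   is also applied to families whose supremum is not a limit ordinal, which is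
   harmless since the derivatives decrease: by [iter_derivative_mono] below the
   value depends only on the ordinal denoted by [a]. *)
Fixpoint iter_derivative rho eps K (a : Ord) : set E :=
  match a with
  | Ozero => K
  | Osucc a' => derivative rho eps (iter_derivative rho eps K a')
  | Osup _ f => K `&` \bigcap_i iter_derivative rho eps K (f i)
  end.

Lemma le_diam rho (S T : set E) : S `<=` T -> (diam rho S <= diam rho T)%E.
Proof.
move=> ST; apply: ereal_sup_le => _ [p [Sp1 Sp2] <-].
by exists p => //; split; exact: ST.
Qed.

Lemma derivative_mono rho eps C C' : C `<=` C' ->
  derivative rho eps C `<=` derivative rho eps C'.
Proof.
move=> CC' x [Cx H]; split=> [|S [g [r [cg ->]]] [_ gx]]; first exact: CC'.
apply: (le_trans (H (C `&` [set z | r < g z]) _ _)) => //; first by exists g, r.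
by apply: le_diam => z [/CC'].
Qed.

Lemma iter_derivative_subset rho eps K a : iter_derivative rho eps K a `<=` K.
Proof. by elim: a => [//|a IH x [/IH]|I f IH x []]. Qed.

Lemma iter_derivative_mono rho eps K a b : Ole a b ->
  iter_derivative rho eps K b `<=` iter_derivative rho eps K a.
Proof.
elim: a b => [|a IH|I f IH] b /=; first by move=> _; exact: iter_derivative_subset.
- elim: b => [//|b _|J g IHg] /=; first by move/IH/derivative_mono; apply.
  by move=> [j /IHg H] x [_ /(_ j I)/H].
- move=> H x bx; split=> [|i _]; first exact: iter_derivative_subset bx.
  exact: IH (H i) _ bx.
Qed.

Definition Dz_eps rho K eps : option Ord :=
  match pselect (exists a, iter_derivative rho eps K a = set0) with
  | left ex => Some (Oleast ex)
  | right _ => None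
  end.

Definition Dz rho K : option Ord :=
  eOsup (fun eps : {eps : R | 0 < eps} => Dz_eps rho K (val eps)).

Definition strictly_convex K (f : E -> R) : Prop :=
  forall x y (l : R), K x -> K y -> x != y -> 0 < l < 1 ->
    f (l *: x + (1 - l) *: y) < l * f x + (1 - l) * f y.

(* Lower semicontinuity is with respect to the relative topology of [K]: in
   [subspace K] the points outside [K] are isolated, so that the values of [f]
   there are irrelevant. *)
Definition class_SC K : Prop :=
  exists f : E -> R,
    lower_semicontinuous (fun x : subspace K => (f x)%:E) /\
    strictly_convex K f.

End Dentability.

(* Main.v *)
(* A symmetric from a function: on some copy c + nu K of K inside K the function
   f is bounded above (a Baire argument), so f may be assumed to be at most N on
   K.  Take for rho the midpoint convexity gap of f.  If C lies in {f <= s} and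
   f x > s - eps/2, a slice of C containing x and missing {f <= s - eps/2} has
   diameter at most eps/2: the midpoint of two of its points is in the halfspace,
   so f > s - eps/2 there.  Hence every derivation lowers f by at least eps/2,
   and omega derivations exhaust K.

   A function from a symmetric: by compactness the derivations for each
   eps = 1/(n+1) stop before omega1, so only countably many derived sets C occur.
   For each of them let b_C be the supremum of the normalized positive heights
   (g - r)/M over the slices of C of diameter less than eps; it is lower
   semicontinuous, convex, bounded, and positive on the points of C that are
   removed by the derivation.  Distinct x and y lie in a common C, at least one of
   them removed, with rho x y >= eps; then b_C^2 is strictly convex on [x, y],
   since otherwise some slice of small diameter would contain both x and y.  A
   weighted sum of the functions b_C^2 is the required function. *)

Require Import Defs.
From mathcomp Require Import all_boot all_order all_algebra.
From mathcomp Require Import all_classical all_reals all_analysis.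
From mathcomp Require Import ring lra.
From HB Require Import structures.

Set Implicit Arguments.
Unset Strict Implicit.
Unset Printing Implicit Defensive.

Import Order.TTheory GRing.Theory Num.Theory.
Import numFieldNormedType.Exports.

Local Open Scope classical_set_scope.
Local Open Scope ring_scope.

(** * Sublinear functionals and the Hahn-Banach theorem *)

Section HahnBanach.
Context (R : realType) (V : lmodType R).
Implicit Types (p : V -> R) (x y : V).

Definition sublinear p :=
  (forall x y, p (x + y) <= p x + p y) /\
  (forall c x, 0 < c -> p (c *: x) <= c * p x).

(** The inequality for [c^-1] gives the reverse one; [p 0 = 0] comes from [p (2 *: 0) = 2 * p 0]. *)
Lemma sublinearZ p c x : sublinear p -> 0 <= c -> p (c *: x) = c * p x.
Proof.
move=> [_ pZ].
have pZe c' x' : 0 < c' -> p (c' *: x') = c' * p x'.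
  move=> c0; apply/eqP; rewrite eq_le pZ //= mulrC -ler_pdivlMr // mulrC.
  have := pZ c'^-1 (c' *: x'); rewrite scalerA mulVf ?gt_eqF // scale1r.
  by apply; rewrite invr_gt0.
rewrite le_eqVlt => /orP[/eqP <-|]; last exact: pZe.
have := pZe 2 0 ltac:(by []); rewrite scaler0 scale0r mul0r; lra.
Qed.

Lemma sublinear0 p : sublinear p -> p 0 = 0.
Proof. by move=> ps; rewrite -(scale0r 0) sublinearZ // mul0r. Qed.

Lemma sublinearN p x : sublinear p -> - p (- x) <= p x.
Proof.
move=> ps; have := ps.1 x (- x); rewrite subrr sublinear0 //; lra.
Qed.

Lemma inf_le_mem (A : set R) (a b : R) :
  (forall z, A z -> b <= z) -> A a -> inf A <= a.
Proof. by move=> H Aa; apply: ge_inf => //; exists b => z /H. Qed.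

(** For sublinear [p] this is the largest sublinear functional below [p] whose value at [- y] is at
    most [- p y]. *)
Definition directional p y x :=
  inf [set p (x + t *: y) - t * p y | t in [set t | 0 <= t]].

Lemma directional_le p x y t : sublinear p -> 0 <= t ->
  directional p y x <= p (x + t *: y) - t * p y.
Proof.
move=> ps t0; apply: (@inf_le_mem _ _ (- p (- x))); last by exists t.
move=> _ [s /= s0 <-]; have := ps.1 (x + s *: y) (- x).
rewrite addrAC subrr add0r sublinearZ //; lra.
Qed.

Lemma le_directional p x y a :
  (forall t, 0 <= t -> a <= p (x + t *: y) - t * p y) -> a <= directional p y x.
Proof.
move=> H; apply: lb_le_inf; first by exists (p (x + 0 *: y) - 0 * p y), 0 => /=.
by move=> _ [t /= t0 <-]; exact: H.
Qed.

Lemma directional_sublinear p y : sublinear p -> sublinear (directional p y).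
Proof.
move=> ps; split=> [x1 x2|c x c0].
- rewrite -lerBlDr; apply: le_directional => t t0.
  rewrite lerBlDr [leRHS]addrC -lerBlDr; apply: le_directional => s s0.
  rewrite lerBlDr; apply: (le_trans (@directional_le p _ _ (t + s) ps _)).
    exact: addr_ge0.
  have := ps.1 (x1 + t *: y) (x2 + s *: y).
  rewrite addrACA -scalerDl; lra.
- rewrite mulrC -ler_pdivrMr //; apply: le_directional => t t0.
  rewrite ler_pdivrMr //.
  apply: (le_trans (@directional_le p _ _ (c * t) ps _)).
    by rewrite mulr_ge0 // ltW.
  rewrite -scalerA -scalerDr (sublinearZ _ ps (ltW c0)).
  by rewrite le_eqVlt; apply/orP; left; apply/eqP; ring.
Qed.

Lemma directional_le_id p x y : sublinear p -> directional p y x <= p x.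
Proof.
move=> ps; have := @directional_le p x y 0 ps (lexx _).
by rewrite scale0r addr0 mul0r subr0.
Qed.

(* A minimal sublinear functional equals its [directional] modification in every
   direction, which forces additivity. *)
Lemma linear_le_sublinear p : sublinear p ->
  exists g : {linear V -> R^o}, forall x, g x <= p x.
Proof.
move=> ps.
pose T := {q | sublinear q /\ forall x, q x <= p x}.
(* The order is reversed, so that Zorn's lemma yields a minimal functional. *)
pose le (q1 q2 : T) := `[< forall x, sval q2 x <= sval q1 x >].
have [|||[q [qs qp]] qmin] := @ZL_preorder T (exist _ p (conj ps (fun=> lexx _))) le.
- by move=> q; apply/asboolP.
- move=> q1 q2 q3 /asboolP H1 /asboolP H2; apply/asboolP => x.
  exact: le_trans (H2 x) (H1 x).
- move=> A Atot; have [[q0 Aq0]|A0] := pselect (A !=set0); last first.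
    exists (exist _ p (conj ps (fun=> lexx _))) => q Aq.
    by case: A0; exists q.
  pose m x := inf [set sval q x | q in A].
  have mle q x : A q -> m x <= sval q x.
    move=> Aq; apply: (@inf_le_mem _ _ (- p (- x))); last by exists q.
    move=> _ [q' Aq' <-]; have [q's q'p] := svalP q'.
    by apply: le_trans (sublinearN x q's); rewrite lerN2.
  have lem a x : (forall q, A q -> a <= sval q x) -> a <= m x.
    move=> H; apply: lb_le_inf; first by exists (sval q0 x), q0.
    by move=> _ [q /H ? <-].
  have ms : sublinear m.
    split=> [x y|c x c0].
      rewrite -lerBlDr; apply: (lem) => q1 Aq1.
      rewrite lerBlDr [leRHS]addrC -lerBlDr; apply: (lem) => q2 Aq2; rewrite lerBlDr.
      have [/asboolP H|/asboolP H] := Atot _ _ Aq1 Aq2.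
        apply: (le_trans (mle q2 _ Aq2)).
        by apply: (le_trans ((svalP q2).1.1 _ _)); rewrite addrC lerD2l; exact: H.
      apply: (le_trans (mle q1 _ Aq1)).
      by apply: (le_trans ((svalP q1).1.1 _ _)); rewrite addrC lerD2r; exact: H.
    rewrite mulrC -ler_pdivrMr //; apply: (lem) => q Aq.
    rewrite ler_pdivrMr // mulrC; apply: (le_trans (mle q _ Aq)).
    exact: (svalP q).1.2.
  exists (exist _ m (conj ms (fun x => le_trans (mle _ x Aq0) ((svalP q0).2 x)))).
  by move=> q Aq; apply/asboolP => x; exact: mle.
- have qdir y x : q x <= directional q y x.
    have dq := conj (directional_sublinear y qs)
      (fun x => le_trans (directional_le_id x y qs) (qp x)).
    have /qmin/asboolP : le (exist _ q (conj qs qp)) (exist _ _ dq).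
      by apply/asboolP => z; exact: directional_le_id.
    exact.
  have qD x y : q (x + y) = q x + q y.
    apply/eqP; rewrite eq_le qs.1 /=.
    have := le_trans (qdir y x) (directional_le x y qs ler01).
    by rewrite scale1r mul1r; lra.
  have qN x : q (- x) = - q x.
    by have := qD x (- x); rewrite subrr sublinear0 //; lra.
  have qlin : linear (q : V -> R^o).
    move=> c x y; rewrite qD; congr (_ + _).
    have [c0|c0] := leP 0 c; first exact: sublinearZ.
    rewrite -[c]opprK scaleNr qN sublinearZ //; last by rewrite oppr_ge0 ltW.
    by rewrite mulNr !opprK.
  pose G : {linear V -> R^o} :=
    HB.pack (q : V -> R^o) (GRing.isLinear.Build R V R^o *:%R q qlin).
  by exists G => x; exact: qp.
Qed.

(** A linear [g] below [directional p x0] satisfies [g (- x0) <= - p x0], which is the bound at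
    [x0]. *)
Lemma linear_le_sublinear_at p x0 : sublinear p ->
  exists g : {linear V -> R^o}, (forall x, g x <= p x) /\ p x0 <= g x0.
Proof.
move=> ps; have [g gp] := linear_le_sublinear (directional_sublinear x0 ps).
exists g; split=> [x|]; first exact: le_trans (gp x) (directional_le_id _ _ ps).
have := le_trans (gp (- x0)) (directional_le (- x0) x0 ps ler01).
by rewrite linearN scale1r addNr sublinear0 //; lra.
Qed.

End HahnBanach.

(** * Gauges and the separation of a point from a closed convex set *)

Section Separation.
Context (R : realType).

Lemma convex_setP (V : lmodType R) (A : set V) : convex_set A ->
  forall x y t, A x -> A y -> 0 <= t <= 1 -> A (t *: x + (1 - t) *: y).
Proof.
move=> Ac x y t Ax Ay t01; apply/set_mem.
have /(_ (Itv01 (andP t01).1 (andP t01).2)) := Ac x y _ (mem_set Ax) (mem_set Ay).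
exact.
Qed.

Section Gauge.
Context (V : lmodType R) (W : set V).
Hypothesis Wconvex :
  forall x y t, W x -> W y -> 0 <= t <= 1 -> W (t *: x + (1 - t) *: y).
Hypothesis Wabsorbing : forall x, exists2 t, 0 < t & W (t *: x).

Definition gauge (x : V) : R := inf [set t | 0 < t /\ W (t^-1 *: x)].

Lemma gauge_le t x : 0 < t -> W (t^-1 *: x) -> gauge x <= t.
Proof. by move=> t0 Wt; apply: ge_inf => //; exists 0 => s [/ltW]. Qed.

Lemma le_gauge a x : (forall t, 0 < t -> W (t^-1 *: x) -> a <= t) -> a <= gauge x.
Proof.
move=> H; apply: lb_le_inf => [|t [t0 Wt]]; last exact: H.
by have [t t0 Wt] := Wabsorbing x; exists t^-1; split; rewrite ?invr_gt0 ?invrK.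
Qed.

(** If [t^-1 *: x] and [s^-1 *: y] lie in [W], their combination with weights [t / (t + s)] and
    [s / (t + s)] is [(t + s)^-1 *: (x + y)]. *)
Lemma gauge_sublinear : sublinear gauge.
Proof.
split=> [x y|c x c0].
- rewrite -lerBlDr; apply: le_gauge => t t0 Wt.
  rewrite lerBlDr [leRHS]addrC -lerBlDr; apply: le_gauge => s s0 Ws.
  rewrite lerBlDr [leRHS]addrC; apply: gauge_le; first exact: addr_gt0.
  have st0 : 0 < t + s by exact: addr_gt0.
  have ts01 : 0 <= t / (t + s) <= 1.
    rewrite divr_ge0 ?(ltW t0) ?(ltW st0) //= ler_pdivrMr // mul1r lerDl.
    exact: ltW.
  have := Wconvex Wt Ws ts01.
  congr W; rewrite !scalerA scalerDr; congr (_ *: _ + _ *: _).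
    by field; rewrite !gt_eqF ?addr_gt0.
  by field; rewrite !gt_eqF ?addr_gt0.
- rewrite mulrC -ler_pdivrMr //; apply: le_gauge => t t0 Wt.
  rewrite ler_pdivrMr //; apply: gauge_le; first exact: mulr_gt0.
  by rewrite invfM scalerA mulfVK ?gt_eqF.
Qed.

Lemma gauge_le1 x : W x -> gauge x <= 1.
Proof. by move=> Wx; apply: gauge_le => //; rewrite invr1 scale1r. Qed.

(** If [t^-1 *: x] is in [W] with [t < 1], then [x] is on the segment from it to [0], and [0] is in
    [W] by absorption. *)
Lemma ge1_gauge x : ~ W x -> 1 <= gauge x.
Proof.
move=> nWx; apply: le_gauge => t t0 Wt; rewrite leNgt; apply/negP => t1.
have [s s0 W0] := Wabsorbing 0; rewrite scaler0 in W0.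
have := Wconvex Wt W0 (_ : 0 <= t <= 1); rewrite (ltW t0) (ltW t1) => /(_ isT).
by rewrite scaler0 addr0 scalerA divff ?gt_eqF // scale1r.
Qed.

End Gauge.

Context (E : tvsType R).
Implicit Types (x : E) (D : set E).

Lemma affine_continuous (c : E) (t : R) : continuous (fun x : E => c + t *: x).
Proof.
move=> x; apply: (@continuous_comp _ _ _ (fun x => (c, t *: x))
  (fun z : E * E => z.1 + z.2)); last exact: add_continuous.
apply: cvg_pair; first exact: cvg_cst.
apply: (@continuous_comp _ (R^o * E)%type _ (fun x => (t, x))
  (fun z : R^o * E => z.1 *: z.2)); last exact: scale_continuous.
by apply: (@cvg_pair _ _ _ _ (nbhs (t : R^o))); [exact: cvg_cst|exact: cvg_id].
Qed.

Lemma nbhs_absorbing (U : set E) x : nbhs 0 U -> exists2 t : R, 0 < t & U (t *: x).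
Proof.
move=> U0.
have [|[A B] /= [A0 B0] AB] := @scale_continuous R E (0, x) U; first by rewrite /= scale0r.
have [e /= e0 eA] : nbhs (0 : R^o) A by exact: A0.
exists (e / 2); first by rewrite divr_gt0.
apply: (AB (e / 2, x)); split => /=; last exact: nbhs_singleton.
apply: eA; rewrite /ball_ /= sub0r normrN gtr0_norm ?divr_gt0 //.
by rewrite ltr_pdivrMr // ltr_pMr // ltr1n.
Qed.

(** For [y] near [x], both [e^-1] and [- e^-1] times [y - x] lie in [U], so [g x] and [g y] differ
    by at most [e]. *)
Lemma linear_bounded_continuous (g : {linear E -> R^o}) (U : set E) :
  nbhs 0 U -> (forall x, U x -> g x <= 1) -> continuous g.
Proof.
move=> U0 gU x; apply/cvgrPdist_le => /= e e0.
have near_shift (c : R) : c != 0 -> \forall y \near x, U (c *: (y - x)).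
  move=> c0; have : \forall y \near x, U (- (c *: x) + c *: y).
    by apply: (@affine_continuous (- (c *: x)) c x U); rewrite addrC subrr.
  by apply: filterS => y; rewrite scalerBr addrC.
have eN0 : e^-1 != 0 by rewrite invr_eq0 gt_eqF.
have := near_shift e^-1 eN0.
have : \forall y \near x, U (- e^-1 *: (y - x)) by apply: near_shift; rewrite oppr_eq0.
apply: filterS2 => y /gU + /gU; rewrite !linearZ /= linearB /=.
rewrite /GRing.scale /= mulNr => H1 H2.
rewrite ler_norml; apply/andP; split.
- by rewrite lerNl opprB -(ler_pM2l (_ : 0 < e^-1)) ?invr_gt0 // mulVf ?gt_eqF.
- rewrite -(ler_pM2l (_ : 0 < e^-1)) ?invr_gt0 // mulVf ?gt_eqF //.
  by rewrite -opprB mulrN.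
Qed.

Lemma nbhs0_convex (U : set E) : nbhs 0 U -> exists V : set E,
  [/\ nbhs 0 V, V `<=` U &
   forall x y t, V x -> V y -> 0 <= t <= 1 -> V (t *: x + (1 - t) *: y)].
Proof.
have [B Bconv [Bopen Bnbhs]] := @locally_convex R E.
move=> /(Bnbhs 0)[V [BV V0] VU]; exists V; split => //.
- by apply: open_nbhs_nbhs; split => //; exact: Bopen.
- by apply: convex_setP; apply: Bconv; exact: mem_set.
Qed.

(** Adding a convex neighbourhood [V] of [0] to [D - d0] gives a convex absorbing [W] that misses
    [x - d0]. A linear functional below its gauge and at least [1] at [x - d0] is bounded above on
    [V], hence continuous. *)
Lemma closed_convex_separation D x : closed D ->
  (forall x y t, D x -> D y -> 0 <= t <= 1 -> D (t *: x + (1 - t) *: y)) ->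
  ~ D x -> exists (g : {linear E -> R^o}) (r : R),
  [/\ continuous g, r < g x & forall y, D y -> g y <= r].
Proof.
move=> Dcl Dconv nDx.
have [[d0 Dd0]|D0] := pselect (D !=set0); last first.
  exists (\0 : {linear E -> R^o}), (-1); split.
  - by move=> y; exact: cst_continuous.
  - by rewrite /= ltrN10.
  - by move=> y Dy; case: D0; exists y.
have [V [V0 VD Vconv]] : exists V : set E, [/\ nbhs 0 V,
    V `<=` [set v | ~ D (x + -1 *: v)] &
    forall x y t, V x -> V y -> 0 <= t <= 1 -> V (t *: x + (1 - t) *: y)].
  apply: nbhs0_convex; apply: (@affine_continuous x (-1) 0 (~` D)).
  rewrite scaler0 addr0; apply: open_nbhs_nbhs; split=> //.
  by rewrite openC.
pose W := [set w | exists d v, [/\ D d, V v & w = d - d0 + v]].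
have VW v : V v -> W v by move=> Vv; exists d0, v; split; rewrite // subrr add0r.
have Wconv w1 w2 t : W w1 -> W w2 -> 0 <= t <= 1 -> W (t *: w1 + (1 - t) *: w2).
  move=> [d1 [v1 [Dd1 Vv1 ->]]] [d2 [v2 [Dd2 Vv2 ->]]] t01.
  exists (t *: d1 + (1 - t) *: d2), (t *: v1 + (1 - t) *: v2).
  split; [exact: Dconv|exact: Vconv|].
  rewrite !scalerDr addrACA; congr (_ + _); rewrite addrACA -scalerDl.
  by rewrite [t + _]addrC subrK scale1r.
have Wabs z : exists2 t : R, 0 < t & W (t *: z).
  by have [t t0 Vt] := nbhs_absorbing z V0; exists t => //; exact: VW.
have nWx : ~ W (x - d0).
  move=> [d [v [Dd Vv]]]; rewrite addrAC => /addIr xE.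
  by apply: VD Vv _; rewrite xE scaleN1r addrK.
have gs := gauge_sublinear Wconv Wabs.
have [g [gle gx]] := linear_le_sublinear_at (x - d0) gs.
have gW w : W w -> g w <= 1 by move=> Ww; exact: le_trans (gle w) (gauge_le1 Ww).
have gx1 : 1 <= g (x - d0) by exact: le_trans (ge1_gauge Wconv Wabs nWx) gx.
have [t t0 Vt] := nbhs_absorbing (x - d0) V0.
(* Since [t *: (x - d0)] lies in [V], adding it to [y - d0] stays in [W]; the positive value of [g]
   at it makes the separation strict. *)
exists g, (g x - g (t *: (x - d0))); split.
- by apply: (linear_bounded_continuous V0) => v /VW; exact: gW.
- rewrite ltrBlDr ltrDl linearZ /= mulr_gt0 //; exact: lt_le_trans gx1.
- move=> y Dy; have : g (y - d0 + t *: (x - d0)) <= 1 by apply: gW; exists y, (t *: (x - d0)).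
  rewrite linearD linearB /=; move: gx1; rewrite linearB /=.
  by move=> H1 H2; lra.
Qed.

End Separation.

(** * Directed intersections in a compact set, and countable ordinals *)

Lemma compact_directed_bigcap (T : topologicalType) (K : set T) (I : Type)
    (F : I -> set T) (i0 : I) :
  compact K -> (forall i, closed (F i)) -> (forall i, F i `<=` K) ->
  (forall i, F i !=set0) -> (forall i j, exists k, F k `<=` F i `&` F j) ->
  \bigcap_i F i !=set0.
Proof.
move=> Kc Fcl FK F0 Fdir.
have FF : ProperFilter (filter_from setT F).
  apply: filter_from_proper; last by move=> i _; exact: F0.
  apply: filter_fromT_filter => [|i j]; first by exists i0.
  by have [k] := Fdir i j; exists k.
have [|x [Kx xcl]] := Kc _ FF; first by exists i0.
exists x => i _; apply: Fcl => U Ux.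
by apply: xcl => //; exists i.
Qed.

Lemma Ocountable_succ a : Ocountable a -> Ocountable (Osucc a).
Proof.
move=> [A [Ac AH]]; exists (A `|` [set a]); split.
  rewrite -bigcup2E; apply: bigcup_countable => // i _; rewrite /bigcup2.
  by case: i => [//|[|i]]; [exact: countable1|exact: countable0].
move=> b ba; have [ab|ba'] := Ole_total a b.
  by exists a; [right|split=> //; exact: ba].
by have [c Ac' cb] := AH _ ba'; exists c => //; left.
Qed.

(** Otherwise [omega1] would lie below a finite ordinal and would be countable. *)
Lemma Ole_finite_omega1 n : Ole (iter n Osucc Ozero) omega1.
Proof.
have [//|H] := Ole_total (iter n Osucc Ozero) omega1.
have cn m : Ocountable (iter m Osucc Ozero).
  elim: m => [|m]; last exact: Ocountable_succ.
  by exists set0; split; [exact: countable0|].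
have [A [Ac AH]] := cn n.
case: omega1P => nc _; exfalso; apply: nc; exists A; split => // b b1.
by apply: AH; exact: Ole_trans b1 (Olt_Ole H).
Qed.

Lemma Ole_omega_omega1 : Ole omega omega1.
Proof. by move=> n; exact: Ole_finite_omega1. Qed.

(** * Derived sets and the stages of the derivation *)

Section Derivation.
Context (R : realType) (E : tvsType R).
Implicit Types (K C : set E) (rho : E -> E -> R).

(** The derived sets decrease, so once empty they stay empty; least ordinals disappear from the
    later arguments. *)
Lemma Dz_leP rho K b : eOle (Dz rho K) (Some b) <->
  forall eps, 0 < eps -> iter_derivative rho eps K b = set0.
Proof.
rewrite /Dz eOsupP; split=> [H eps eps0|H [eps eps0]].
- have := H (exist _ eps eps0); rewrite /Dz_eps /=; case: pselect => // ex /=.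
  rewrite /Oleast; case: cid => a /= [a0 _] ab.
  by apply/seteqP; split => // x /(iter_derivative_mono ab); rewrite a0.
- rewrite /Dz_eps /=; case: pselect => [ex|[]]; last by exists b; exact: H.
  by rewrite /Oleast /=; case: cid => a /= [_]; apply; exact: H.
Qed.

(** A slice through a limit point also contains points of the derivative, and these force it to be
    large. *)
Lemma closed_derivative rho eps C : closed C -> closed (derivative rho eps C).
Proof.
move=> Ccl x xcl; have Cx : C x.
  by apply: Ccl => U /xcl [y [[Cy _] Uy]]; exists y.
split=> // S [g [r [gc SE]]] Sx.
have gx : r < g x by move: Sx; rewrite SE => -[].
have : nbhs x [set z | r < g z].
  apply: open_nbhs_nbhs; split=> //.
  by move/continuousP : gc => /(_ [set z : R^o | r < z]); apply; exact: open_gt.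
move=> /xcl[y [[Cy yS] gy]]; apply: yS; last by rewrite SE.
by exists g, r.
Qed.

Lemma closed_iter_derivative rho eps K a : closed K ->
  closed (iter_derivative rho eps K a).
Proof.
move=> Kcl; elim: a => [//|a IH|I f IH]; first exact: closed_derivative.
by apply: closedI => //; apply: closed_bigI => i _; exact: IH.
Qed.

(** Compactness rules out a first vanishing at a limit: directed nonempty closed subsets of [K] have
    a common point. For [b = omega1] this leaves a stage [a] below [omega1], hence countable. *)
Lemma iter_derivative_eq0_succ rho eps K b : K !=set0 -> compact K -> closed K ->
  iter_derivative rho eps K b = set0 ->
  exists2 a, Olt a b & iter_derivative rho eps K (Osucc a) = set0.
Proof.
move=> [x0 Kx0] Kc Kcl; elim: b => [K0|a _ H|J f IH H].
- by have : set0 x0 by rewrite -K0.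
- by exists a => //; exact: Ole_refl.
- have [[i Hi]|nH] := pselect (exists i, iter_derivative rho eps K (f i) = set0).
    by have [a ai a0] := IH i Hi; exists a => //; exists i.
  (* For an empty index type the intersection is [K], which is nonempty. *)
  have [[i0]|J0] := pselect (inhabited J); last first.
    have : set0 x0; last by [].
    by rewrite -H; split=> // i; case: J0.
  have [||i||x xP] := @compact_directed_bigcap E K J
      (fun i => iter_derivative rho eps K (f i)) i0 Kc.
  + by move=> i; exact: closed_iter_derivative.
  + by move=> i; exact: iter_derivative_subset.
  + by apply/set0P/eqP => Hi; apply: nH; exists i.
  + move=> i j; have [ij|/Olt_Ole ji] := Ole_total (f i) (f j).
      by exists j => x xj; split=> //; exact: iter_derivative_mono ij _ xj.
    by exists i => x xi; split=> //; exact: iter_derivative_mono ji _ xi.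
  + have : set0 x; last by [].
    by rewrite -H; split=> //; have := xP i0 I; exact: iter_derivative_subset.
Qed.

(** Limit stages are intersections, so a pair cannot be broken exactly at a limit: a single
    derivation, applied to a stage containing both points, does it. *)
Lemma iter_derivative_exit rho eps K b x y : K x -> K y ->
  ~ (iter_derivative rho eps K b x /\ iter_derivative rho eps K b y) ->
  exists a, [/\ Olt a b, iter_derivative rho eps K a x,
    iter_derivative rho eps K a y &
    ~ (iter_derivative rho eps K (Osucc a) x /\
       iter_derivative rho eps K (Osucc a) y)].
Proof.
move=> Kx Ky; elim: b => [[]//|b IH nb|I f IH nb].
- have [[bx by_]|/IH [a [ab ax ay na]]] :=
    pselect (iter_derivative rho eps K b x /\ iter_derivative rho eps K b y).
    by exists b; split => //; exact: Ole_refl.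
  by exists a; split=> //; exact: Ole_trans ab (Ole_succ _).
- have [[i ni]|nH] := pselect (exists i,
    ~ (iter_derivative rho eps K (f i) x /\ iter_derivative rho eps K (f i) y)).
    by have [a [ai ax ay na]] := IH i ni; exists a; split=> //; exists i.
  have H i : iter_derivative rho eps K (f i) x /\ iter_derivative rho eps K (f i) y.
    by apply: contrapT => ni; apply: nH; exists i.
  by case: nb; split; split=> // i _; have [] := H i.
Qed.

End Derivation.

(** * Lower semicontinuous functions and boundedness on a copy of [K] *)

Section Functions.
Context (R : realType) (E : tvsType R).
Implicit Types (K C U : set E) (f : E -> R) (x y : E).

(** Relative lower semicontinuity in terms of neighbourhoods in [E], which avoids the subspace
    topology. *)
Definition lsc_on K f := forall x a, K x -> a < f x ->
  \forall y \near x, K y -> a < f y.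

Lemma lsc_onP K f :
  lower_semicontinuous (fun x : subspace K => (f x)%:E) <-> lsc_on K f.
Proof.
split=> [flsc x a Kx afx|flsc x a afx].
- have [|V] := flsc x a; first by rewrite lte_fin.
  move=> /(nbhs_subspace_ex _ Kx)[W Wx VW] HV; apply: filterS Wx => y Wy Ky.
  have [Vy _] : (V `&` K) y by rewrite VW.
  by have := HV y Vy; rewrite lte_fin.
- have [Kx|nKx] := pselect (K x); last first.
    exists [set x]; last by move=> y ->.
    by apply: open_nbhs_nbhs; split=> //; exact: open_subspace1out.
  exists [set y | a < f y]; last by move=> y; rewrite lte_fin.
  apply/(nbhs_subspace_ex _ Kx); exists [set y | K y -> a < f y].
    by apply: flsc; rewrite // -lte_fin.
  by apply/seteqP; split=> y [] //= ay Ky; split=> //; exact: ay.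
Qed.

Lemma closed_sublevel K f t : closed K -> lsc_on K f ->
  closed [set z | K z /\ f z <= t].
Proof.
move=> Kcl flsc x xcl; have Kx : K x.
  by apply: Kcl => U /xcl [y [[Ky _] Uy]]; exists y.
split=> //; rewrite leNgt; apply/negP => /(flsc _ _ Kx) /xcl[y [[Ky fy] H]].
by have := H Ky; rewrite ltNge fy.
Qed.

Lemma strictly_convex_le K f x y t : strictly_convex K f -> K x -> K y ->
  0 <= t <= 1 -> f (t *: x + (1 - t) *: y) <= t * f x + (1 - t) * f y.
Proof.
move=> fsc Kx Ky /andP[t0 t1].
have [->|xy] := eqVneq x y.
  by rewrite -scalerDl -mulrDl addrC subrK scale1r mul1r.
move: t0; rewrite le_eqVlt => /orP[/eqP<-|t0].
  by rewrite subr0 !scale0r !scale1r !mul0r !mul1r !add0r.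
move: t1; rewrite le_eqVlt => /orP[/eqP->|t1].
  by rewrite subrr !scale0r !scale1r !mul0r !mul1r !addr0.
by apply: ltW; apply: fsc => //; rewrite t0.
Qed.

(** At [t = 0] all of [K] is sent to [x]; compactness makes the admissible [t] uniform in [k]. *)
Lemma compact_shrink K U x : compact K -> nbhs x U ->
  exists2 t : R, 0 < t <= 1 & forall k, K k -> U (x + t *: (k - x)).
Proof.
move=> /compact_near_coveringP Kc Ux.
pose P (t : R^o) k := U (x + t *: (k - x)).
have [k Kk|e /= e0 eP] := Kc R^o (nbhs (0 : R^o)) P _.
  have H : x + z.2 *: (z.1 - x) @[z --> (k, 0 : R^o)] --> x + 0 *: (k - x).
    apply: continuous2_cvg; [exact: (@add_continuous E (_, _))|exact: cvg_cst|].
    apply: continuous2_cvg; [exact: (@scale_continuous R E (_, _))|exact: cvg_snd|].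
    apply: continuous2_cvg; [exact: (@add_continuous E (_, _))|exact: cvg_fst|exact: cvg_cst].
  by move: (H U); rewrite scale0r addr0 => /(_ Ux).
have m0 : 0 < Num.min (e / 2) 1 by rewrite lt_min divr_gt0 //=.
exists (Num.min (e / 2) 1); first by rewrite m0 ge_min lexx orbT.
move=> k Kk; apply: eP => //=.
rewrite /ball_ /= sub0r normrN gtr0_norm // gt_min; apply/orP; left.
by rewrite ltr_pdivrMr // ltr_pMr // ltr1n.
Qed.

(* Baire's category argument: otherwise there are nested copies [c_n + nu_n K]
   of [K] in [K] with [f > n] on the [n]-th one, and [f] is infinite at a common
   point. *)
Lemma bounded_on_affine_copy K f :
  (forall x y t, K x -> K y -> 0 <= t <= 1 -> K (t *: x + (1 - t) *: y)) ->
  K !=set0 -> compact K -> hausdorff_space E -> lsc_on K f ->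
  exists c (nu N : R), 0 < nu /\
    forall k, K k -> K (c + nu *: k) /\ f (c + nu *: k) <= N.
Proof.
move=> Kconv [x0 Kx0] Kc hE flsc.
have [//|unb] := pselect (exists c (nu N : R), 0 < nu /\
    forall k, K k -> K (c + nu *: k) /\ f (c + nu *: k) <= N).
(* A pair [(c, nu)] encodes the copy [c + nu K] of [K] inside [K]. *)
pose S := {p : E * R | 0 < p.2 /\ forall k, K k -> K (p.1 + p.2 *: k)}.
pose img (s : S) := (fun k => (sval s).1 + (sval s).2 *: k) @` K.
have step (sn : S * nat) : exists s' : S, img s' `<=` img sn.1 /\
    forall z, img s' z -> sn.2%:R < f z.
  case: sn => -[[c nu] /= [nu0 Kcnu]] n /=.
  have [k0 [Kk0 fk0]] : exists k, K k /\ n%:R < f (c + nu *: k).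
    apply: contrapT => H; apply: unb; exists c, nu, n%:R; split => // k Kk.
    split; first exact: Kcnu.
    by rewrite leNgt; apply/negP => nf; apply: H; exists k.
  set z0 := c + nu *: k0 in fk0.
  have Kz0 : K z0 by exact: Kcnu.
  have [m /andP[m0 m1] mU] := compact_shrink Kc (flsc _ _ Kz0 fk0).
  (* [E1] writes the contraction of the copy towards [z0] as a new copy; [E2], with convexity,
     places it inside the old one. *)
  have E1 k : (1 - m) *: z0 + m *: c + (m * nu) *: k = z0 + m *: (c + nu *: k - z0).
    rewrite scalerBl scale1r !scalerBr !scalerDr scalerA -!addrA; congr (_ + _).
    by rewrite scalerA; congr (_ + _); rewrite addrC -addrA.
  have E2 k : z0 + m *: (c + nu *: k - z0) = c + nu *: (m *: k + (1 - m) *: k0).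
    rewrite /z0 opprD addrACA subrr add0r -scalerBr -addrA scalerA mulrC -scalerA -scalerDr.
    congr (_ + _ *: _); rewrite scalerBr scalerBl scale1r.
    by rewrite addrCA.
  have m01 : 0 <= m <= 1 by rewrite ltW.
  have pP : 0 < m * nu /\ forall k, K k -> K ((1 - m) *: z0 + m *: c + (m * nu) *: k).
    split; first exact: mulr_gt0.
    by move=> k Kk; rewrite E1 E2; apply: Kcnu; exact: Kconv.
  exists (exist _ ((1 - m) *: z0 + m *: c, m * nu) pP); split=> z [k /= Kk <-].
    by rewrite E1 E2; exists (m *: k + (1 - m) *: k0) => //; exact: Kconv.
  rewrite E1; apply: mU; first exact: Kcnu.
  by rewrite E2; apply: Kcnu; exact: Kconv.
have [next nextP] := choice step.
have init : 0 < (0 : E, 1 : R).2 /\ forall k, K k -> K ((0 : E, 1 : R).1 + (0 : E, 1 : R).2 *: k).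
  by split=> //= k; rewrite add0r scale1r.
pose s := fix s n := if n is m.+1 then next (s m, m) else exist _ (0, 1) init : S.
have simg i j : (i <= j)%N -> img (s j) `<=` img (s i).
  move: i j; apply: (@homo_leq _ (fun n => img (s n)) (fun A B => B `<=` A)).
  - by move=> A.
  - by move=> B A C BA CB; exact: subset_trans CB BA.
  - by move=> i; have [] := nextP (s i, i).
have [i|i|i|i j|x xP] := @compact_directed_bigcap E K nat (fun n => img (s n)) 0%N Kc.
- apply: compact_closed => //; apply: continuous_compact => //.
  by apply: continuous_subspaceT; exact: affine_continuous.
- by move=> _ [k Kk <-]; exact: (svalP (s i)).2.
- by exists ((sval (s i)).1 + (sval (s i)).2 *: x0), x0.
- by exists (maxn i j) => z iz; split; apply: simg iz; rewrite ?leq_maxl ?leq_maxr.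
(* The bound [n < f] holds on the copy of index [n.+1]; with [n] the successor of the truncation of
   [f x], it contradicts [f x < n]. *)
have := (nextP (s (Num.truncn (f x)).+1, (Num.truncn (f x)).+1)).2 x (xP (Num.truncn (f x)).+2 Logic.I).
by move=> /= /(lt_trans (truncnS_gt _)); rewrite ltxx.
Qed.

(** The function is pulled back along the map from [k] to [c + nu k], which is affine, continuous
    and injective and so preserves both properties. *)
Lemma class_SC_bounded K : hausdorff_space E -> convex_set K -> compact K ->
  K !=set0 -> class_SC K ->
  exists g (N : R), [/\ lsc_on K g, strictly_convex K g & forall x, K x -> g x <= N].
Proof.
move=> hE /convex_setP Kconv Kc K0 [f [/lsc_onP flsc fsc]].
have [c [nu [N [nu0 cP]]]] := bounded_on_affine_copy Kconv K0 Kc hE flsc.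
exists (fun x => f (c + nu *: x)), N; split.
- move=> x a Kx ax.
  have : \forall y \near x, K (c + nu *: y) -> a < f (c + nu *: y).
    apply: (@affine_continuous R E c nu x [set z | K z -> a < f z]).
    by apply: flsc => //; exact: (cP x Kx).1.
  by apply: filterS => y H Ky; apply: H; exact: (cP y Ky).1.
- move=> x y t Kx Ky xy t01.
  have -> : c + nu *: (t *: x + (1 - t) *: y) =
      t *: (c + nu *: x) + (1 - t) *: (c + nu *: y).
    rewrite !scalerDr addrACA -scalerDl [t + _]addrC subrK scale1r.
    by rewrite !scalerA ![nu * _]mulrC.
  apply: fsc => //; [exact: (cP x Kx).1|exact: (cP y Ky).1|].
  apply: contra_neq xy => /addrI H.
  by apply: (scalerI (lt0r_neq0 nu0)).
- by move=> x Kx; exact: (cP x Kx).2.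
Qed.

End Functions.

(** * From a strictly convex function to a symmetric *)

Section StrictlyConvexToSymmetric.
Context (R : realType) (E : tvsType R) (K : set E) (f : E -> R) (N : R).
Hypotheses (K_convex : convex_set K) (K_compact : compact K)
  (K_closed : closed K) (f_lsc : lsc_on K f) (f_sc : strictly_convex K f)
  (f_le : forall x, K x -> f x <= N).

(** The second weight is written [1 - 2^-1] to match [strictly_convex] at [l = 2^-1]. *)
Definition convexity_gap (x y : E) : R :=
  2^-1 * f x + (1 - 2^-1) * f y - f (2^-1 *: x + (1 - 2^-1) *: y).

Let half : 1 - 2^-1 = 2^-1 :> R.
Proof. by field. Qed.

Let half01 : 0 <= (2^-1 : R) <= 1.
Proof. by rewrite invr_ge0 ler0n invf_le1 ?ler1n. Qed.

Lemma symmetric_convexity_gap : symmetric_on K convexity_gap.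
Proof.
move=> x y Kx Ky; split.
- by rewrite subr_ge0; exact: (strictly_convex_le f_sc Kx Ky half01).
- rewrite /convexity_gap half [2^-1 *: y + _]addrC; congr (_ - _); exact: addrC.
- split=> [/eqP|->]; last first.
    have yE : 2^-1 *: y + (1 - 2^-1) *: y = y.
      by rewrite -scalerDl addrC subrK scale1r.
    by rewrite /convexity_gap yE; field.
  rewrite subr_eq0 => /eqP xyE; apply/eqP; apply: contraT => xy.
  have : 0 < (2^-1 : R) < 1 by apply/andP; split; lra.
  by move=> /(f_sc Kx Ky xy); rewrite xyE ltxx.
Qed.

Lemma iter_derivative_sublevel eps n x : 0 < eps ->
  iter_derivative convexity_gap eps K (iter n Osucc Ozero) x ->
  f x <= N - n%:R * (eps / 2).
Proof.
move=> eps0; elim: n x => [x Kx|n IH x].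
  by rewrite mul0r subr0; exact: f_le.
rewrite iterS; set C := iter_derivative _ _ _ (iter n _ _) in IH *.
move=> /= -[Cx xP]; rewrite leNgt; apply/negP.
set t := N - _ => tfx.
have CK : C `<=` K by exact: iter_derivative_subset.
have Kconv := convex_setP K_convex.
have [|||g [r [gc rgx gr]]] := @closed_convex_separation R E [set z | K z /\ f z <= t] x.
- exact: closed_sublevel.
- move=> y z s [Ky fy] [Kz fz] s01; split; first exact: Kconv.
  apply: (le_trans (strictly_convex_le f_sc Ky Kz s01)).
  have : s * f y <= s * t by rewrite ler_wpM2l //; case/andP: s01.
  have : (1 - s) * f z <= (1 - s) * t.
    by rewrite ler_wpM2l // subr_ge0; case/andP: s01.
  by lra.
- by case=> _; rewrite leNgt tfx.
have := xP (C `&` [set z | r < g z]) _ _.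
have /[swap]/[apply] : slice C (C `&` [set z | r < g z]) by exists g, r.
have /[swap]/[apply] : (C `&` [set z | r < g z]) x by [].
apply/negP; rewrite -ltNge.
apply: (@le_lt_trans _ _ (eps / 2)%:E); last first.
  by rewrite lte_fin ltr_pdivrMr // ltr_pMr // ltr1n.
apply: ge_ereal_sup => _ [[u v] /= [[Cu gu] [Cv gv]] <-]; rewrite lee_fin.
set m := 2^-1 *: u + (1 - 2^-1) *: v.
have tfm : t < f m.
  rewrite ltNge; apply/negP => fm.
  have : g m <= r by apply: gr; split=> //; apply: Kconv => //; exact: CK.
  apply/negP; rewrite -ltNge /m half linearD !linearZ /=.
  rewrite /GRing.scale /=; lra.
(* By induction [f u] and [f v] are at most [t + eps / 2], while [f m > t], so the gap is below
   [eps / 2]. *)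
have := IH u Cu; have := IH v Cv.
rewrite /convexity_gap -/m half; move: tfm; rewrite /t -natr1; lra.
Qed.

Lemma Dz_convexity_gap : eOle (Dz convexity_gap K) (Some omega).
Proof.
apply/Dz_leP => eps eps0; apply/seteqP; split=> // x [Kx xP].
have d0 : 0 < eps / 2 by rewrite divr_gt0.
(* Large enough for the bound after [n] derivations to fall below [f x]. *)
set n := (Num.truncn ((N - f x) / (eps / 2))).+1.
have := @iter_derivative_sublevel eps n x eps0 (xP n Logic.I).
have : (N - f x) / (eps / 2) < n%:R by exact: truncnS_gt.
rewrite ltr_pdivrMr //; lra.
Qed.

End StrictlyConvexToSymmetric.

(** * Enumerations and bounds for functionals *)

Lemma countable_enumeration (T : Type) (x0 : T) (A : set T) : countable A ->
  exists c : nat -> T, A `<=` range c.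
Proof.
move=> /countable_injP[e einj].
have /choice[c cP] (n : nat) : exists x, forall y, A y -> e y = n -> x = y.
  have [[y [Ay yn]]|H] := pselect (exists y, A y /\ e y = n); last first.
    by exists x0 => y Ay yn; case: H; exists y.
  exists y => z Az zn; apply: einj; rewrite ?inE //; congruence.
by exists c => y Ay; exists (e y) => //; exact: cP.
Qed.

Lemma compact_linear_bounded (R : realType) (E : tvsType R) (K : set E)
    (g : E -> R^o) : compact K -> closed K -> continuous g ->
  exists M : R, forall z, K z -> g z <= M.
Proof.
move=> Kc Kcl gc; apply: contrapT => unb.
have [n|n|n|i j|x xP] := @compact_directed_bigcap E K nat
  (fun n => K `&` g @^-1` [set z : R^o | n%:R <= z]) 0%N Kc.
- apply: closedI => //; move/continuous_closedP : gc; apply; exact: closed_ge.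
- by move=> z [].
- apply: contrapT => H; apply: unb; exists n%:R => z Kz.
  by rewrite leNgt; apply/negP => gz; apply: H; exists z; split=> //; exact: ltW.
- exists (maxn i j) => z [Kz /= gz]; split; split=> //=; apply: le_trans gz;
    by rewrite ler_nat ?leq_maxl ?leq_maxr.
have [_ /=] := xP (Num.truncn (g x)).+1 Logic.I.
by apply/negP; rewrite -ltNge; exact: truncnS_gt.
Qed.

Lemma height_combination (R : realType) (V : lmodType R)
    (g : {linear V -> R^o}) (x y : V) (t r M : R) : 0 < M ->
  (g (t *: x + (1 - t) *: y) - r) / M =
  t * ((g x - r) / M) + (1 - t) * ((g y - r) / M).
Proof.
move=> M0; have -> : g (t *: x + (1 - t) *: y) = t * g x + (1 - t) * g y :> R.
  by rewrite linearD !linearZ.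
move: (g x : R) (g y : R) => u v; field; exact: lt0r_neq0.
Qed.

(** * Bump functions built from slices of small diameter *)

Section Bump.
Context (R : realType) (E : tvsType R) (K : set E) (rho : E -> E -> R).
Hypotheses (K_compact : compact K) (K_closed : closed K)
  (K_convex : convex_set K).
Variables (C : set E) (eps : R).
Hypothesis CK : C `<=` K.

(* Normalized heights above the slices of [C] of small diameter. *)
Definition bump_values (x : E) : set R := [set 0] `|`
  [set v | exists (g : {linear E -> R^o}) (r M : R),
    [/\ continuous g, 0 < M, forall z, K z -> g z - r <= M,
        (diam rho (C `&` [set z | r < g z]%R) < eps%:E)%E & v = (g x - r) / M]].

(** A supremum of continuous affine functions and [0]: the value [0] makes it nonnegative, and
    division by [M] keeps it at most [1] on [K]. *)
Definition bump (x : E) : R := sup (bump_values x).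

Lemma bump_values_le1 x : K x -> ubound (bump_values x) 1.
Proof.
move=> Kx _ [->|[g [r [M [gc M0 gM _ ->]]]]]; first exact: ler01.
by rewrite ler_pdivrMr // mul1r; exact: gM.
Qed.

Lemma le_bump x v : K x -> bump_values x v -> v <= bump x.
Proof. by move=> Kx; apply: ub_le_sup; exists 1; exact: bump_values_le1. Qed.

Lemma lt_bump x a : a < bump x -> exists2 v, bump_values x v & a < v.
Proof. by apply: sup_gt; exists 0; left. Qed.

Lemma bump_ge0 x : K x -> 0 <= bump x.
Proof. by move=> Kx; apply: le_bump => //; left. Qed.

Lemma bump_le1 x : K x -> bump x <= 1.
Proof.
move=> Kx; apply: ge_sup; first by exists 0; left.
exact: bump_values_le1.
Qed.

Lemma bump_lsc : lsc_on K bump.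
Proof.
move=> x a Kx /lt_bump[v [->|[g [r [M [gc M0 gM gd ->]]]]] av].
  by apply: nearW => y Ky; exact: lt_le_trans av (bump_ge0 Ky).
move: av; rewrite ltr_pdivlMr // ltrBrDr => av.
have : nbhs x [set z | a * M + r < g z].
  apply: open_nbhs_nbhs; split=> //.
  by move/continuousP : gc => /(_ [set z : R^o | a * M + r < z]); apply; exact: open_gt.
apply: filterS => y /= ay Ky.
have : bump_values y ((g y - r) / M) by right; exists g, r, M; split.
move=> /(le_bump Ky); apply: lt_le_trans.
by rewrite ltr_pdivlMr // ltrBrDr.
Qed.

Lemma bump_convex x y t : K x -> K y -> 0 <= t <= 1 ->
  bump (t *: x + (1 - t) *: y) <= t * bump x + (1 - t) * bump y.
Proof.
move=> Kx Ky /andP[t0 t1]; have t1' : 0 <= 1 - t by rewrite subr_ge0.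
apply: ge_sup; first by exists 0; left.
move=> _ [->|[g [r [M [gc M0 gM gd ->]]]]].
  by rewrite addr_ge0 // mulr_ge0 // bump_ge0.
have Bx : (g x - r) / M <= bump x by apply: le_bump => //; right; exists g, r, M.
have By : (g y - r) / M <= bump y by apply: le_bump => //; right; exists g, r, M.
have -> : (g (t *: x + (1 - t) *: y) - r) / M =
    t * ((g x - r) / M) + (1 - t) * ((g y - r) / M).
  exact: height_combination.
by apply: lerD; exact: ler_wpM2l.
Qed.

Lemma bump_gt0 x : C x -> ~ derivative rho eps C x -> 0 < bump x.
Proof.
move=> Cx nC; apply: contrapT => b0; apply: nC; split=> // S [g [r [gc SE]]] Sx.
rewrite leNgt; apply/negP => Sd; apply: b0.
have [M0 M0P] := compact_linear_bounded K_compact K_closed gc.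
pose M := Num.max 1 (M0 - r).
have Mgt0 : 0 < M by rewrite lt_max ltr01.
have : bump_values x ((g x - r) / M).
  right; exists g, r, M; split=> //; last by rewrite -SE.
  by move=> z Kz; rewrite le_max; apply/orP; right; rewrite lerD2r; exact: M0P.
move=> /(le_bump (CK Cx)); apply: lt_le_trans.
by rewrite divr_gt0 // subr_gt0; move: Sx; rewrite SE => -[].
Qed.

(* Near the supremum, a functional that is high at an interior point of the
   segment is positive at both ends, which then lie in a common small slice. *)
Lemma bump_sqr_strict x y t : C x -> C y -> eps <= rho x y -> 0 < t < 1 ->
  ~ (derivative rho eps C x /\ derivative rho eps C y) ->
  bump (t *: x + (1 - t) *: y) ^+ 2 < t * bump x ^+ 2 + (1 - t) * bump y ^+ 2.
Proof.
move=> Cx Cy xy /andP[t0 t1] nC; set m := t *: x + _.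
have [Kx Ky] := (CK Cx, CK Cy).
have t1' : 0 < 1 - t by rewrite subr_gt0.
have mle : bump m <= t * bump x + (1 - t) * bump y.
  by apply: bump_convex => //; rewrite !ltW.
have [bx0 by0] := (bump_ge0 Kx, bump_ge0 Ky).
rewrite ltNge; apply/negP => mge.
have bm0 : 0 <= bump m.
  by apply: bump_ge0; apply: convex_setP => //; rewrite !ltW.
have m2 : bump m ^+ 2 <= (t * bump x + (1 - t) * bump y) ^+ 2.
  by rewrite ler_sqr ?nnegrE // addr_ge0 // mulr_ge0 // ltW.
(* With [a] and [b] the values at [x] and [y], [t a^2 + (1 - t) b^2] exceeds [(t a + (1 - t) b)^2]
   by [t (1 - t) (a - b)^2], which must vanish here. *)
have bxy : bump x = bump y.
  apply/eqP; rewrite -subr_eq0 -sqrf_eq0 eq_le sqr_ge0 andbT.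
  have tt : 0 < t * (1 - t) by exact: mulr_gt0.
  rewrite -(ler_pM2l tt) mulr0; nra.
have bmE : bump m = bump y.
  apply/eqP; rewrite eq_le; apply/andP; split; first by rewrite bxy in mle; lra.
  rewrite -ler_sqr ?nnegrE //; rewrite bxy in mge; lra.
have s0 : 0 < bump y.
  rewrite lt0r by0 andbT; apply/eqP => s0; apply: nC.
  have [nx|] := pselect (derivative rho eps C x); last first.
    by move/(bump_gt0 Cx); rewrite bxy s0 ltxx.
  split=> //; apply: contrapT => /(bump_gt0 Cy).
  by rewrite s0 ltxx.
(* The endpoints contribute at most [t * bump y] and [(1 - t) * bump y] to the height at [m]. Above
   this threshold neither suffices alone, so both contributions are positive. *)
have [|v] := @lt_bump m (Num.max t (1 - t) * bump y).
  rewrite bmE gtr_pMl // gt_max t1 /=; lra.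
move=> [->|[g [r [M [gc M0 gM gd ->]]]]].
  by rewrite ltNge mulr_ge0 // le_max ltW.
have Bx : (g x - r) / M <= bump y.
  by rewrite -bxy; apply: le_bump => //; right; exists g, r, M.
have By : (g y - r) / M <= bump y by apply: le_bump => //; right; exists g, r, M.
have -> : (g m - r) / M = t * ((g x - r) / M) + (1 - t) * ((g y - r) / M).
  exact: height_combination.
move=> H.
have H1 : t * bump y < t * ((g x - r) / M) + (1 - t) * ((g y - r) / M).
  by apply: le_lt_trans H; rewrite ler_wpM2r // le_max lexx.
have H2 : (1 - t) * bump y < t * ((g x - r) / M) + (1 - t) * ((g y - r) / M).
  by apply: le_lt_trans H; rewrite ler_wpM2r // le_max lexx orbT.
have B1 : t * ((g x - r) / M) <= t * bump y by rewrite ler_pM2l.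
have B2 : (1 - t) * ((g y - r) / M) <= (1 - t) * bump y by rewrite ler_pM2l.
have gx : r < g x.
  rewrite -subr_gt0 -(pmulr_lgt0 _ (_ : 0 < M^-1)) ?invr_gt0 //.
  by rewrite -(pmulr_rgt0 _ t0); lra.
have gy : r < g y.
  rewrite -subr_gt0 -(pmulr_lgt0 _ (_ : 0 < M^-1)) ?invr_gt0 //.
  by rewrite -(pmulr_rgt0 _ t1'); lra.
move: gd; apply/negP; rewrite -leNgt.
apply: (@le_trans _ _ (rho x y)%:E); first by rewrite lee_fin.
by apply: ereal_sup_ubound; exists (x, y).
Qed.

End Bump.

(** * Weighted sums of lower semicontinuous convex functions *)

Lemma lsc_onD (R : realType) (E : tvsType R) (K : set E) (f g : E -> R) :
  lsc_on K f -> lsc_on K g -> lsc_on K (fun x => f x + g x).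
Proof.
move=> flsc glsc x a Kx afg; pose d := (f x + g x - a) / 2.
have d0 : 0 < d by rewrite divr_gt0 // subr_gt0.
have fd : f x - d < f x by rewrite gtrBl.
have gd : g x - d < g x by rewrite gtrBl.
have := glsc _ _ Kx gd; have := flsc _ _ Kx fd; apply: filterS2 => y Hf Hg Ky.
by have := Hf Ky; have := Hg Ky; rewrite /d; lra.
Qed.

Lemma lsc_onZ (R : realType) (E : tvsType R) (K : set E) (f : E -> R) (c : R) :
  0 < c -> lsc_on K f -> lsc_on K (fun x => f x * c).
Proof.
move=> c0 flsc x a Kx; rewrite -ltr_pdivrMr // => /(flsc _ _ Kx).
by apply: filterS => y H /H; rewrite ltr_pdivrMr.
Qed.

Lemma lsc_on_sqr (R : realType) (E : tvsType R) (K : set E) (f : E -> R) :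
  (forall x, K x -> 0 <= f x) -> lsc_on K f -> lsc_on K (fun x => f x ^+ 2).
Proof.
move=> f0 flsc x a Kx ax; have [a0|a0] := ltP a 0.
  by apply: nearW => y Ky; exact: lt_le_trans a0 (sqr_ge0 _).
have : Num.sqrt a < f x.
  by rewrite -(@ltr_pXn2r _ 2) ?nnegrE ?sqrtr_ge0 ?f0 // sqr_sqrtr.
move=> /(flsc _ _ Kx); apply: filterS => y H /[dup] Ky /H.
by rewrite -(@ltr_pXn2r _ 2) ?nnegrE ?sqrtr_ge0 ?f0 // sqr_sqrtr.
Qed.

Section WeightedSum.
Context (R : realType) (E : tvsType R) (K : set E) (phi : nat -> E -> R).
Hypotheses (K_convex : convex_set K) (phi_lsc : forall k, lsc_on K (phi k))
  (phi01 : forall k x, K x -> 0 <= phi k x <= 1)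
  (phi_convex : forall k x y t, K x -> K y -> 0 < t < 1 ->
    phi k (t *: x + (1 - t) *: y) <= t * phi k x + (1 - t) * phi k y)
  (phi_strict : forall x y, K x -> K y -> x != y -> exists k, forall t,
    0 < t < 1 ->
    phi k (t *: x + (1 - t) *: y) < t * phi k x + (1 - t) * phi k y).

Let u (x : E) (k : nat) : R := phi k x * 2^-1 ^+ k.

Let w0 k : 0 < (2^-1 : R) ^+ k.
Proof. by rewrite exprn_gt0 // invr_gt0. Qed.

Let u0 x k : K x -> 0 <= u x k.
Proof. by move=> Kx; rewrite mulr_ge0 ?(ltW (w0 k)) //; case/andP: (phi01 k Kx). Qed.

Let cvg_u x : K x -> cvgn (series (u x)).
Proof.
move=> Kx; apply: (@series_le_cvg _ _ (geometric 1 2^-1)) => [k|k|k|].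
- exact: u0.
- by rewrite /geometric /= mul1r ltW.
- by rewrite /geometric /= ler_wpM2r ?(ltW (w0 k)) //; case/andP: (phi01 k Kx).
- by apply: is_cvg_geometric_series; rewrite gtr0_norm ?invr_gt0 // invf_lt1 // ltr1n.
Qed.

(** The partial sums increase, so a lower bound valid for one of them persists in the limit. The
    convexity defects are nonnegative, so a single strict one makes the sum strictly convex. *)
Lemma weighted_sum_class_SC : class_SC K.
Proof.
exists (fun x => limn (series (u x))); split.
- apply/lsc_onP => x a Kx ax.
  have [n an] : exists n, a < series (u x) n.
    apply: contrapT => H; move: ax; apply/negP; rewrite -leNgt.
    apply: limr_le; first exact: cvg_u.
    by apply: nearW => n; rewrite leNgt; apply/negP => an; apply: H; exists n.
  have lscn : lsc_on K (fun y => series (u y) n).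
    elim: n {an} => [|n IH].
      move=> y b _; rewrite /series /= big_geq // => b0.
      by apply: nearW => z _; rewrite big_geq.
    have := lsc_onD IH (lsc_onZ (w0 n) (@phi_lsc n)).
    congr lsc_on; apply/funext => y.
    by rewrite /series /= big_nat_recr.
  have := lscn _ _ Kx an; apply: filterS => y H /[dup] Ky /H.
  move=> /lt_le_trans; apply; apply: nondecreasing_cvgn_le; last exact: cvg_u.
  by apply: nondecreasing_series => i _ _; exact: u0.
- move=> x y t Kx Ky xy t01; set m := t *: x + _.
  have Km : K m by apply: convex_setP => //; case/andP: t01 => *; rewrite !ltW.
  pose d k := t * u x k + (1 - t) * u y k - u m k.
  have d0 k : 0 <= d k.
    rewrite /d /u !mulrA -mulrDl -mulrBl mulr_ge0 ?(ltW (w0 k)) // subr_ge0.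
    exact: phi_convex.
  have dE : series d = (fun n => t * series (u x) n + (1 - t) * series (u y) n
      - series (u m) n).
    apply/funext => n; rewrite /series /= /d sumrB big_split /=.
    by rewrite !mulr_sumr.
  have dcvg : series d @ \oo --> t * limn (series (u x)) +
      (1 - t) * limn (series (u y)) - limn (series (u m)).
    rewrite dE; apply: cvgB; last exact: cvg_u.
    by apply: cvgD; apply: cvgMl_tmp; exact: cvg_u.
  have [k kP] := phi_strict Kx Ky xy.
  rewrite -subr_gt0 -(cvg_lim _ dcvg) //.
  (* The partial sum of index [k.+1] is the first to include the strict term [d k]. *)
  apply: (@lt_le_trans _ _ (series d k.+1)); last first.
    apply: nondecreasing_cvgn_le; last by apply/cvg_ex; exists (t * limn (series (u x)) +
      (1 - t) * limn (series (u y)) - limn (series (u m))).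
    by apply: nondecreasing_series.
  rewrite /series /= big_nat_recr //= ltr_wpDl //.
    by apply: sumr_ge0 => i _; exact: d0.
  rewrite /d /u !mulrA -mulrDl -mulrBl mulr_gt0 // subr_gt0.
  exact: kP.
Qed.

End WeightedSum.

(** * From a symmetric to a strictly convex function *)

Section SymmetricToStrictlyConvex.
Context (R : realType) (E : tvsType R) (K : set E) (rho : E -> E -> R).

Lemma class_SC_of_Dz : K !=set0 -> convex_set K -> compact K -> closed K ->
  symmetric_on K rho -> eOle (Dz rho K) (Some omega1) -> class_SC K.
Proof.
move=> K0 Kconv Kc Kcl rhoS /Dz_leP HDz.
pose e (n : nat) : R := n.+1%:R^-1.
have e0 n : 0 < e n by rewrite invr_gt0.
pose D n a := iter_derivative rho (e n) K a.
have DK n a : D n a `<=` K by exact: iter_derivative_subset.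
have /choice[c cP] (n : nat) : exists c : nat -> Ord, forall x y, K x -> K y ->
    exists j, [/\ D n (c j) x, D n (c j) y &
      ~ (D n (Osucc (c j)) x /\ D n (Osucc (c j)) y)].
  (* One derivation after stage [a] nothing is left, and [a] is below [omega1]; so the stages up to
     [a] can be enumerated. *)
  have [a a1 Da] := iter_derivative_eq0_succ K0 Kc Kcl (HDz _ (e0 n)).
  have [A [Ac AH]] := Ocountable_succ (omega1P.2 a a1).
  have [c cA] := countable_enumeration Ozero Ac.
  exists c => x y Kx Ky.
  have [|b [ba bx by_ nb]] := @iter_derivative_exit R E rho (e n) K (Osucc a) x y Kx Ky.
    by rewrite Da => -[].
  have [b' /cA[j _ <-] [jb bj]] := AH b ba.
  (* [c j] is only [Oeq] to [b]; this suffices, as the derived sets depend on the ordinal alone. *)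
  have DE : D n (c j) = D n b.
    by apply/seteqP; split; exact: iter_derivative_mono.
  exists j; rewrite DE; split=> //.
  by rewrite /D /= -/(D n (c j)) DE.
(* This decodes a parameter and a stage; numbers coding no pair repeat the function of [(0, 0)]. *)
pose idx k := odflt (0, 0)%N (unpickle k).
pose phi k x := bump K rho (D (idx k).1 (c (idx k).1 (idx k).2)) (e (idx k).1) x ^+ 2.
apply: (@weighted_sum_class_SC R E K phi) => //.
- by move=> k; apply: lsc_on_sqr; [exact: bump_ge0|exact: bump_lsc].
- move=> k x Kx; rewrite sqr_ge0 /= expr_le1 //; first exact: bump_le1.
  exact: bump_ge0.
- move=> k x y t Kx Ky /andP[t0 t1]; rewrite /phi.
  set b := bump _ _ _ _.
  have t1' : 0 < 1 - t by rewrite subr_gt0.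
  have Km : K (t *: x + (1 - t) *: y) by apply: convex_setP => //; rewrite !ltW.
  have H : b (t *: x + (1 - t) *: y) <= t * b x + (1 - t) * b y.
    by apply: bump_convex => //; rewrite !ltW.
  have [bx0 by0] : 0 <= b x /\ 0 <= b y by split; exact: bump_ge0.
  apply: (@le_trans _ _ ((t * b x + (1 - t) * b y) ^+ 2)).
    by rewrite ler_sqr ?nnegrE ?bump_ge0 // addr_ge0 // mulr_ge0 // ltW.
  have tt : 0 <= t * (1 - t) * (b x - b y) ^+ 2.
    by rewrite mulr_ge0 ?sqr_ge0 // mulr_ge0 // ltW.
  nra.
- move=> x y Kx Ky xy.
  have [rho0 _ rhoE] := rhoS x y Kx Ky.
  have rgt0 : 0 < rho x y.
    rewrite lt0r rho0 andbT; apply/eqP => /rhoE H.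
    by move: xy; rewrite H eqxx.
  (* This makes [e n] at most [rho x y], so no slice of diameter less than [e n] contains both
     points. *)
  pose n := Num.truncn (rho x y)^-1.
  have er : e n <= rho x y.
    rewrite /e invf_ple ?posrE //; apply: ltW; exact: truncnS_gt.
  have [j [jx jy nj]] := cP n x y Kx Ky.
  exists (pickle (n, j)) => t t01; rewrite /phi /idx pickleK /=.
  exact: bump_sqr_strict.
Qed.

End SymmetricToStrictlyConvex.

Theorem proposition5p1 (R : realType) (E : tvsType R) (K : set E)
    (hausdorffE : hausdorff_space E)
    (K_nonempty : K !=set0) (K_convex : convex_set K) (K_compact : compact K) :
  (class_SC K <->
     exists rho, symmetric_on K rho /\ eOle (Dz rho K) (Some omega)) /\
  (class_SC K <->
     exists rho, symmetric_on K rho /\ eOle (Dz rho K) (Some omega1)).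
Proof.
have K_closed : closed K by exact: compact_closed.
have ab : class_SC K ->
    exists rho, symmetric_on K rho /\ eOle (Dz rho K) (Some omega).
  move=> /(class_SC_bounded hausdorffE K_convex K_compact K_nonempty).
  move=> [g [N [glsc gsc gN]]]; exists (convexity_gap g); split.
    exact: symmetric_convexity_gap.
  exact: (@Dz_convexity_gap _ _ _ g N).
have bc rho : eOle (Dz rho K) (Some omega) -> eOle (Dz rho K) (Some omega1).
  by case: (Dz rho K) => //= a H; exact: Ole_trans H Ole_omega_omega1.
have ca : (exists rho, symmetric_on K rho /\ eOle (Dz rho K) (Some omega1)) ->
    class_SC K.
  by move=> [rho [rhoS rhoDz]]; exact: (@class_SC_of_Dz _ _ _ rho).
split; split=> //.
- by move=> [rho [rhoS /bc rhoDz]]; apply: ca; exists rho.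
- by move=> /ab [rho [rhoS /bc rhoDz]]; exists rho.
Qed.
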